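(* Let $n\ge 2$ be an integer, let $\ell$ be a positive integer and let $r_1,\dots,r_\ell$ be a sequence of positive integers. Then the set $Z^0(n,\ell;r_1,\dots,r_\ell)$ is a Zariski-open subset of $Z(n,\ell;r_1,\dots,r_\ell)$, and therefore a Zariski-open subset of $\mathbf{A}^n=\mathbb{C}^n$.
   Context: $\mathbf{A}^n=\mathbb{C}^n$ denotes the affine space of all monic complex polynomials $g(x)=x^n+\sum_{i=0}^{n-1}a_ix^i$ of degree $n$, identified with their coefficient vectors $(a_0,\dots,a_{n-1})\in\mathbb{C}^n$. For a positive integer $r$, $g^{\circ r}$ denotes the $r$-fold composition of $g$ with itself. $Z_{n,r}\subset\mathbf{A}^n$ is the (Zariski-open, dense) set of all monic degree $n$ polynomials $g$ such that $g^{\circ r}(x)-x$ has no multiple roots. $Z(n,\ell;r_1,\dots,r_\ell):=\bigcap_{i=1}^{\ell}Z_{n,r_i}$; it is a Zariski-open subset of $\mathbf{A}^n$ containing $x^n$. Let $g_0\in Z(n,\ell;r_1,\dots,r_\ell)$. If $\beta\in\mathbb{C}$ is a periodic point of $z\mapsto g_0(z)$ of exact period $r=r_i$, then $\beta$ is a simple root of $g_0^{\circ r}(x)-x$, so by the implicit function theorem it extends uniquely to a holomorphic function $g\mapsto\beta(g)$ of the coefficients $(a_0,\dots,a_{n-1})$ in a neighbourhood of $g_0$ with $g^{\circ r}(\beta(g))=\beta(g)$ and $\beta(g_0)=\beta$. Define, near $g_0$, the holomorphic function $\mathrm{Mult}_{\beta,r}(g):=[g^{\circ r}]'(\beta(g))$,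 and let $\mathrm{grad}(\mathrm{Mult}_{\beta,r})|_{g_0}\in\mathbb{C}^n$ be its vector of partial derivatives with respect to $a_0,\dots,a_{n-1}$ at $g_0$. $Z^0(n,\ell;r_1,\dots,r_\ell)$ is the set of all $g_0\in Z(n,\ell;r_1,\dots,r_\ell)$ such that, for every choice of $\beta_1,\dots,\beta_\ell\in\mathbb{C}$ with $\beta_i$ a periodic point of $z\mapsto g_0(z)$ of exact period $r_i$ for each $i$ and with $\beta_1,\dots,\beta_\ell$ lying in pairwise distinct orbits of $z\mapsto g_0(z)$, the $\ell$ vectors $\mathrm{grad}(\mathrm{Mult}_{\beta_i,r_i})|_{g_0}$ ($1\le i\le\ell$) are linearly independent in $\mathbb{C}^n$. *)

(* Defs.v *)
From HB Require Import structures.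
From mathcomp Require Import all_boot all_order all_algebra.
From mathcomp Require Import all_classical all_reals all_analysis.
From mathcomp Require Export complex.
From mathcomp Require mpoly.

Set Implicit Arguments.
Unset Strict Implicit.
Unset Printing Implicit Defensive.

Import Order.TTheory GRing.Theory Num.Theory.
Import numFieldNormedType.Exports.

Local Open Scope classical_set_scope.
Local Open Scope ring_scope.

(* Everything is stated over a numClosedFieldType C carrying the topology of
   its norm; the field of complex numbers is C := R[i] with R : realType.
   Differentiability of maps between normed C-modules is then C-linear Frechet
   differentiability, that is, complex differentiability. *)

Section Affine.
Variables (C : numClosedFieldType) (n : nat).

Definition zariski_closed (X : set 'rV[C]_n) : Prop :=
  exists S : set (mpoly.mpoly n C),
    X = [set a | forall p, S p -> mpoly.meval (fun i => a 0 i) p = 0].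

Definition zariski_open (U : set 'rV[C]_n) : Prop := zariski_closed (~` U).

Definition zariski_open_in (Y U : set 'rV[C]_n) : Prop :=
  exists2 V, zariski_open V & U = Y `&` V.

(* A^n is 'rV[C]_n: the entry a 0 i is the coefficient of 'X^i, and the
   leading term 'X^n is implicit. *)
Definition monic_of (a : 'rV[C]_n) : {poly C} :=
  'X^n + \sum_(i < n) a 0 i *: 'X^i.

End Affine.

Section Dynamics.
Variable C : numClosedFieldType.

Definition comp_iter (r : nat) (g : {poly C}) : {poly C} :=
  iter r (fun p => g \Po p) 'X.

Definition multiple_root (p : {poly C}) (x : C) : bool :=
  ('X - x%:P) ^+ 2 %| p.

Definition exact_period (g : {poly C}) (r : nat) (x : C) : Prop :=
  [/\ (0 < r)%N, iter r (horner g) x = x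
    & forall k, (0 < k < r)%N -> iter k (horner g) x <> x].

Definition forward_orbit (g : {poly C}) (x : C) : set C :=
  [set iter k (horner g) x | k in [set: nat]].

End Dynamics.

Section Multiplier.
Variables (C : numClosedFieldType) (n : nat).
Implicit Types (a : 'rV[C]_n) (r : nat).

(* b is a holomorphic continuation g |-> beta(g), near a0, of the periodic
   point beta of monic_of a0. *)
Definition is_continuation r a0 (beta : C) (b : 'rV[C]_n -> C) : Prop :=
  b a0 = beta /\
  \forall a \near a0,
    differentiable b a /\ (comp_iter r (monic_of a)).[b a] = b a.

(* When beta is a simple root of g^{o r} - 'X, the continuation exists and its
   germ at a0 is unique, so the derivatives at a0 do not depend on the
   choice; the constant function is only a dummy default value. *)
Definition continuation r a0 (beta : C) : 'rV[C]_n -> C :=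
  xget (fun=> beta) [set b | is_continuation r a0 beta b].

Definition Mult r a0 (beta : C) (a : 'rV[C]_n) : C :=
  (deriv (comp_iter r (monic_of a))).[continuation r a0 beta a].

Definition grad (f : 'rV[C]_n -> C) a : 'rV[C]_n :=
  \row_(i < n) 'D_(delta_mx 0 i) f a.

Definition Zr r : set 'rV[C]_n :=
  [set a | forall x, ~~ multiple_root (comp_iter r (monic_of a) - 'X) x].

Definition Z (l : nat) (r : 'I_l -> nat) : set 'rV[C]_n :=
  \bigcap_(i in [set: 'I_l]) Zr (r i).

Definition Z0 (l : nat) (r : 'I_l -> nat) : set 'rV[C]_n :=
  [set a | Z r a /\
    forall beta : 'I_l -> C,
      (forall i, exact_period (monic_of a) (r i) (beta i)) ->
      (forall i j, i != j ->
         forward_orbit (monic_of a) (beta i)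
           <> forward_orbit (monic_of a) (beta j)) ->
      free [tuple grad (Mult (r i) a (beta i)) a | i < l]].

End Multiplier.

Arguments Z C n {l} r.
Arguments Z0 C n {l} r.

(* Main.v *)
Require Import Defs.
From mathcomp Require Import all_boot all_order all_algebra all_fingroup.
From mathcomp Require Import all_classical all_reals all_analysis.
From mathcomp Require Import ring.
From mathcomp Require mpoly.
Import -(notations) mpoly.

Set Implicit Arguments.
Unset Strict Implicit.
Unset Printing Implicit Defensive.

Import Order.TTheory GRing.Theory Num.Theory.
Import numFieldNormedType.Exports.

Local Open Scope classical_set_scope.
Local Open Scope ring_scope.

(* Put [P_r(a, x) = g^{o r}(x) - x], monic in [x] with coefficients polynomial
   in [a].  Over [Z] the roots of [P_r] are simple, so for two roots [x], [y]
   the condition [x <> y] is closed: it says that the divided difference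
   [(P_r(a, x) - P_r(a, y)) / (x - y)] vanishes.  Hence "exact period [r_i]" and
   "distinct orbits" are polynomial equations in [(a, beta)].  Implicit
   differentiation gives the gradient of the multiplier as a polynomial vector
   divided by [1 - (g^{o r})'(beta) <> 0], so linear dependence is the vanishing
   of all maximal minors, again polynomial.  Finally each [beta_i] is a root of
   a monic polynomial, so the projection to [a] of this closed set is closed:
   a common root of [P] and [Q] exists iff [det Q(M) = 0], where [M] is the
   companion matrix of [P], and the [beta_i] are eliminated one at a time.

   The holomorphic continuation is built without an implicit function theorem:
   [b(a)] is a root of [P_r(a, .)] such that
   [|b(a) - beta|^N <= |P_r(a, beta)|], and its differentiability is read off
   [b(a) - b(a1) = - P_r(a, b(a1)) / D], with [D] the divided difference of
   [P_r(a, .)] at [b(a)] and [b(a1)]. *)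

(** * Elimination of roots of monic polynomials *)

(** When [u * char_poly M + v * q = 1], Cayley-Hamilton makes [v(M)] an inverse of [q(M)];
    conversely, an eigenvector of [M] for a common root is killed by [q(M)]. *)
Lemma det_horner_mx_eq0 (C : closedFieldType) d (M : 'M[C]_d.+1)
    (q : {poly C}) :
  \det (horner_mx M q) = 0 <-> exists x, root (char_poly M) x /\ root q x.
Proof.
split=> [det0|[x [xM xq]]].
  apply: contrapT => noroot.
  have /Bezout_eq1_coprimepP[[u v] /= uv1] : coprimep (char_poly M) q.
    apply/Pdiv.ClosedField.coprimepP => x xM; apply/negP => xq.
    by apply: noroot; exists x.
  have := congr1 (fun p => \det (horner_mx M p)) uv1.
  rewrite rmorphD !rmorphM /= Cayley_Hamilton mulr0 add0r rmorph1 -mulmxE.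
  by rewrite det_mulmx det0 mulr0 det1 => /eqP; rewrite eq_sym oner_eq0.
have : eigenvalue M x by rewrite eigenvalue_root_char.
case/eigenvalueP => v vM v0; apply/eqP/det0P; exists v => //.
have /factor_theorem[q' ->] := xq.
rewrite mulrC rmorphM rmorphB /= horner_mx_X horner_mx_C -mulmxE mulmxA.
by rewrite mulmxBr vM mul_mx_scalar subrr mul0mx.
Qed.

Lemma exists_char_poly (A : comNzRingType) d (P : {poly A}) :
  P \is monic -> size P = d.+2 -> exists M : 'M[A]_d.+1, char_poly M = P.
Proof.
move=> Pmon sP; have := companionmxK Pmon.
by move: (companionmx P); rewrite sP => M; exists M.
Qed.

(** [N], a resultant, is computed once over [A]: determinants and characteristic polynomials commute
    with every [ev]. *)
Lemma elimination1 (A : comNzRingType) (C : closedFieldType) (P Q : {poly A}) :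
  P \is monic -> (1 < size P)%N ->
  exists N : A, forall ev : {rmorphism A -> C},
    ev N = 0 <-> exists x, root (map_poly ev P) x /\ root (map_poly ev Q) x.
Proof.
move=> Pmon; case sP: (size P) => [|[|d]] // _.
have [M MP] := exists_char_poly Pmon sP; exists (\det (horner_mx M Q)) => ev.
by rewrite -det_map_mx map_horner_mx det_horner_mx_eq0 -map_char_poly MP.
Qed.

(** Polynomiality is recorded on functions, as a closure property, so that the coefficient ring [A]
    can change while unknowns are eliminated. *)
Inductive polyfun (A C : comNzRingType) (T : Type) (ev : T -> A -> C)
    (l : nat) : (T -> ('I_l -> C) -> C) -> Prop :=
| polyfun_coef a : polyfun ev (fun t _ => ev t a)
| polyfun_var i : polyfun ev (fun _ b => b i)
| polyfunD f g : polyfun ev f -> polyfun ev g ->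
    polyfun ev (fun t b => f t b + g t b)
| polyfunM f g : polyfun ev f -> polyfun ev g ->
    polyfun ev (fun t b => f t b * g t b).

Section PolyfunTheory.
Variables (A C : comNzRingType) (T : Type) (ev : T -> {rmorphism A -> C}).
Variable l : nat.
Implicit Types f g : T -> ('I_l -> C) -> C.
Local Notation pf := (@polyfun A C T (fun t => ev t) l).

Lemma eq_polyfun f g : (forall t b, f t b = g t b) -> pf f -> pf g.
Proof. by move=> fg; have -> : f = g by apply/funext => t; apply/funext. Qed.

Lemma polyfun_nat k : pf (fun _ (_ : 'I_l -> C) => k%:R).
Proof.
by apply: eq_polyfun (polyfun_coef _ _ k%:R) => t b; rewrite rmorph_nat.
Qed.

Lemma polyfun_sum (I : Type) (s : seq I) (P : pred I) F :
  (forall i, pf (F i)) ->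
  pf (fun t b => \sum_(i <- s | P i) F i t b).
Proof.
move=> hF; elim: s => [|i s IHs].
  by apply: eq_polyfun (polyfun_nat 0) => t b; rewrite big_nil.
case Pi : (P i); last by apply: eq_polyfun IHs => t b; rewrite big_cons Pi.
by apply: eq_polyfun (polyfunD (hF i) IHs) => t b; rewrite big_cons Pi.
Qed.

Lemma polyfun_prod (I : Type) (s : seq I) (P : pred I) F :
  (forall i, pf (F i)) ->
  pf (fun t b => \prod_(i <- s | P i) F i t b).
Proof.
move=> hF; elim: s => [|i s IHs].
  by apply: eq_polyfun (polyfun_nat 1) => t b; rewrite big_nil.
case Pi : (P i); last by apply: eq_polyfun IHs => t b; rewrite big_cons Pi.
by apply: eq_polyfun (polyfunM (hF i) IHs) => t b; rewrite big_cons Pi.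
Qed.

Lemma polyfunX f k : pf f -> pf (fun t b => f t b ^+ k).
Proof.
move=> hf; elim: k => [|k IHk]; first exact: eq_polyfun (polyfun_nat 1).
by apply: eq_polyfun (polyfunM hf IHk) => t b; rewrite exprS.
Qed.

Lemma polyfun_horner (Q : {poly A}) f : pf f ->
  pf (fun t b => (map_poly (ev t) Q).[f t b]).
Proof.
move=> hf; elim/poly_ind: Q => [|Q c IHQ].
  by apply: eq_polyfun (polyfun_nat 0) => t b; rewrite map_poly0 horner0.
apply: eq_polyfun (polyfunD (polyfunM IHQ hf) (polyfun_coef _ _ c)) => t b.
by rewrite rmorphD rmorphM /= map_polyX map_polyC !hornerE.
Qed.

Lemma polyfun_det m (F : 'I_m -> 'I_m -> T -> ('I_l -> C) -> C) :
  (forall i j, pf (F i j)) ->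
  pf (fun t b => \det (\matrix_(i, j) F i j t b)).
Proof.
move=> hF; apply: polyfun_sum => s; apply: polyfunM.
  apply: eq_polyfun (polyfun_coef _ _ ((-1) ^+ odd_perm s)) => t b.
  by rewrite rmorph_sign.
apply: eq_polyfun (polyfun_prod (F := fun i => F i (s i)) _ _ _) => //=.
by move=> t b; apply: eq_bigr => i _; rewrite mxE.
Qed.

End PolyfunTheory.

Definition cons_fun (C : Type) l (x : C) (b : 'I_l -> C) (i : 'I_l.+1) : C :=
  if unlift ord0 i is Some j then b j else x.

Section Adjoin.
Variables (A : comNzRingType) (C : closedFieldType) (T : Type).
Variable ev : T -> {rmorphism A -> C}.

(** The first unknown becomes the indeterminate of [{poly A}] and its value joins the parameter,
    which leaves one unknown fewer. *)
Definition ev_adjoin (tx : T * C) : {rmorphism {poly A} -> C} :=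
  horner_eval tx.2 \o map_poly (ev tx.1).

Lemma polyfun_adjoin l f : @polyfun A C T (fun t => ev t) l.+1 f ->
  polyfun (fun tx => ev_adjoin tx)
    (fun tx (b : 'I_l -> C) => f tx.1 (cons_fun tx.2 b)).
Proof.
elim=> {f} [a|i|f g _ IHf _ IHg|f g _ IHf _ IHg].
- apply: eq_polyfun (polyfun_coef _ _ (a%:P)) => -[t x] b /=.
  by rewrite map_polyC horner_evalE hornerC.
- case: (unliftP ord0 i) => [j ->|->].
    apply: eq_polyfun (polyfun_var _ j) => -[t x] b /=.
    by rewrite /cons_fun liftK.
  apply: eq_polyfun (polyfun_coef _ _ 'X) => -[t x] b /=.
  by rewrite map_polyX horner_evalE hornerX /cons_fun unlift_none.
- exact: polyfunD.
- exact: polyfunM.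
Qed.
End Adjoin.

Lemma polyfun_no_var (A C : comNzRingType) T (ev : T -> {rmorphism A -> C}) f :
  polyfun (fun t => ev t : A -> C) f ->
  exists N, forall t (b : 'I_0 -> C), f t b = ev t N.
Proof.
elim=> {f} [a|[]//|f g _ [N hN] _ [N' hN']|f g _ [N hN] _ [N' hN']].
- by exists a.
- by exists (N + N') => t b; rewrite rmorphD hN hN'.
- by exists (N * N') => t b; rewrite rmorphM hN hN'.
Qed.

(** By induction on [l]: over [{poly A}] all unknowns but the first are eliminated, leaving some
    [N : {poly A}]; [elimination1] applied to [P ord0] and [N] removes the first one. *)
Lemma elimination (C : closedFieldType) l (A : comNzRingType) T
    (ev : T -> {rmorphism A -> C}) (P : 'I_l -> {poly A}) f :
  (forall i, P i \is monic) -> (forall i, 1 < size (P i))%N ->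
  polyfun (fun t => ev t : A -> C) f ->
  exists N : A, forall t, ev t N = 0 <->
    exists b, (forall i, root (map_poly (ev t) (P i)) (b i)) /\ f t b = 0.
Proof.
elim: l A T ev P f => [|l IHl] A T ev P f Pmon sP hf.
  have [N hN] := polyfun_no_var hf; exists N => t.
  split=> [<-|[b [_ <-]]]; last by rewrite hN.
  by exists (fun=> 0); split; [case|exact: hN].
have [|i|N hN] := IHl _ _ (ev_adjoin ev)
    (fun i => map_poly polyC (P (lift ord0 i))) _ _ _ (polyfun_adjoin hf).
- by move=> i; apply: monic_map.
- by rewrite size_map_inj_poly //; exact: polyC_inj.
have [N' hN'] := @elimination1 A C (P ord0) N (Pmon _) (sP _).
exists N' => t; rewrite hN'; split=> [[x [xP]]|[b [bP fb]]].
  move=> /rootP xN; have /hN[b [bP fb]] : ev_adjoin ev (t, x) N = 0 by [].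
  exists (cons_fun x b); split=> // i; rewrite /cons_fun.
  case: unliftP => [j ->|-> //]; move: (bP j).
  rewrite -map_poly_comp /= (eq_map_poly (g := ev t)) // => a /=.
  by rewrite map_polyC horner_evalE hornerC.
exists (b ord0); split=> //; apply/rootP.
suff /hN : exists c : 'I_l -> C,
    (forall i, root (map_poly (ev_adjoin ev (t, b ord0))
       (map_poly polyC (P (lift ord0 i)))) (c i)) /\
    f t (cons_fun (b ord0) c) = 0 by [].
exists (fun i => b (lift ord0 i)); split=> [i|].
  rewrite -map_poly_comp /= (eq_map_poly (g := ev t)) // => a /=.
  by rewrite map_polyC horner_evalE hornerC.
rewrite -[RHS]fb; congr f; apply/funext => i; rewrite /cons_fun.
by case: unliftP => [j ->|->].
Qed.

(* An existential over finitely many root tuples commutes with the equations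
   [E m = 0] because the latter are encoded by the polynomial
   [\sum_m E m s ^+ m] vanishing at every [s]. *)
Lemma elimination_system (C : closedFieldType) l (A : comNzRingType) T
    (ev : T -> {rmorphism A -> C}) (P : 'I_l -> {poly A}) (I : finType)
    (E : I -> T -> ('I_l -> C) -> C) (lift_C : {rmorphism C -> A}) :
  (forall t, cancel lift_C (ev t)) ->
  (forall i, P i \is monic) -> (forall i, 1 < size (P i))%N ->
  (forall m, polyfun (fun t => ev t : A -> C) (E m)) ->
  exists N : C -> A, forall t, (forall s, ev t (N s) = 0) <->
    exists b, (forall i, root (map_poly (ev t) (P i)) (b i)) /\
              forall m, E m t b = 0.
Proof.
move=> liftK Pmon sP hE.
have hEs s : polyfun (fun t => ev t : A -> C)
    (fun t b => \sum_m E m t b * s ^+ (enum_rank m)).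
  apply: polyfun_sum => m; apply: polyfunM => //; apply: polyfunX.
  by apply: eq_polyfun (polyfun_coef _ _ (lift_C s)) => t b; rewrite liftK.
have [N hN] := choice (fun s => elimination Pmon sP (hEs s)).
exists N => t; split=> [N0|[b [bP Eb]] s]; last first.
  by apply/hN; exists b; split=> //; rewrite big1 // => m _; rewrite Eb mul0r.
have rootsP i : {rs : seq C | forall x,
      root (map_poly (ev t) (P i)) x = (x \in rs)}.
  have lc1 : lead_coef (map_poly (ev t) (P i)) = 1.
    by apply/monicP/monic_map.
  have := closed_field_poly_normal (map_poly (ev t) (P i)).
  rewrite lc1 => -[rs]; rewrite scale1r => ->.
  by exists rs => x; rewrite root_prod_XsubC.
pose q b : {poly C} := \sum_m E m t b *: 'X^(enum_rank m).
have qE b s : (q b).[s] = \sum_m E m t b * s ^+ (enum_rank m).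
  by rewrite horner_sum; apply: eq_bigr => m _; rewrite hornerZ hornerXn.
have coef_q b m : (q b)`_(enum_rank m) = E m t b.
  rewrite coef_sum (bigD1 m) //= coefZ coefXn eqxx mulr1 big1 ?addr0 // => j jm.
  rewrite coefZ coefXn (inj_eq val_inj) (inj_eq enum_rank_inj) eq_sym.
  by rewrite (negPf jm) mulr0.
pose rs i := sval (rootsP i).
pose b_of (h : {dffun forall i : 'I_l, seq_sub (rs i)}) i := val (h i).
have [h /eqP qh0|no_h] := pickP (fun h => q (b_of h) == 0).
  exists (b_of h); split=> [i|m]; last by rewrite -coef_q qh0 coef0.
  by rewrite (svalP (rootsP i)); exact: valP.
(* If each of the finitely many root tuples violates some equation, this product is nonzero and has
   a non-root [s]; but the tuple supplied by [N0 s] makes one factor vanish at [s]. *)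
have : \prod_h q (b_of h) != 0 by apply/prodf_neq0 => h _; rewrite no_h.
case/closed_nonrootP => s /negP[]; have /hN[b [bP Eb]] := N0 s.
rewrite rootE horner_prod; apply/eqP.
have bin i : b i \in rs i by rewrite -(svalP (rootsP i)).
pose h : {dffun forall i, seq_sub (rs i)} := [ffun i => SeqSub (bin i)].
rewrite (bigD1 h) //= [X in X * _](_ : _ = 0) ?mul0r //.
rewrite qE -[RHS]Eb; apply: eq_bigr => m _; congr (E m t _ * _).
by apply/funext => i; rewrite /b_of /h ffunE.
Qed.

(** * Simple roots, minors and periodic points *)

(** A full-rank matrix has [l] independent columns; conversely, the inverse of a nonzero minor,
    padded with zero rows, is a right inverse of [M]. A repeated column only gives a zero minor, so
    [f] may range over all functions. *)
Lemma row_free_minor (F : fieldType) l n (M : 'M[F]_(l, n)) :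
  row_free M <-> exists f : {ffun 'I_l -> 'I_n}, \det (colsub f M) != 0.
Proof.
split=> [Mfree|[f detf]].
  have MTfull : row_full M^T by rewrite /row_full mxrank_tr.
  exists (fullrankfun MTfull); have := fullrowsub_unit MTfull.
  rewrite unitmxE unitfE -det_tr; congr (\det _ != 0).
  by apply/matrixP => i j; rewrite !mxE.
apply/row_freeP; exists ((colsub f 1%:M) *m invmx (colsub f M)).
by rewrite mulmxA mulmx_colsub mulmx1 mulmxV // unitmxE unitfE.
Qed.

(** The quotient [(p(x) - p(y)) / (x - y)], expanded so as to be polynomial in the coefficients, [x]
    and [y]; on the diagonal it is the derivative. *)
Definition divdiff (R : pzRingType) N (p : nat -> R) (x y : R) : R :=
  \sum_(k < N) p k * \sum_(i < k) x ^+ (k.-1 - i) * y ^+ i.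

Section DividedDifference.
Variable F : fieldType.
Implicit Types (p : {poly F}) (x y : F).

Lemma divdiffP N p x y : (size p <= N)%N ->
  p.[x] - p.[y] = (x - y) * divdiff N (nth 0 p) x y.
Proof.
move=> sp; rewrite !(horner_coef_wide _ sp) -sumrB mulr_sumr.
by apply: eq_bigr => k _; rewrite -mulrBr subrXX mulrCA.
Qed.

Lemma divdiffxx N p x : (size p <= N)%N -> divdiff N (nth 0 p) x x = p^`().[x].
Proof.
move=> sp; have -> : p = \sum_(k < N) p`_k *: 'X^k.
  by rewrite -poly_def; apply/polyP => i; rewrite coef_poly;
     case: ltnP => // /(leq_trans sp) /leq_sizeP ->.
rewrite raddf_sum horner_sum /=; apply: eq_bigr => k _.
rewrite -poly_def coef_poly ltn_ord derivZ derivXn hornerZ hornerMn hornerXn.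
congr (_ * _); rewrite (eq_bigr (fun=> x ^+ k.-1)).
  by rewrite sumr_const card_ord.
move=> i _; rewrite -exprD subnK // -ltnS prednK //.
exact: leq_ltn_trans (ltn_ord i).
Qed.

Lemma double_rootE p x : (('X - x%:P) ^+ 2 %| p) = root p x && root p^`() x.
Proof.
apply/idP/andP => [/dvdpP[q ->]|[/factor_theorem[q ->]]].
  split; first by rewrite expr2 mulrA rootM root_XsubC eqxx orbT.
  by rewrite rootE derivM deriv_exp hornerD !hornerM hornerMn hornerM
    horner_exp hornerXsubC subrr !(mulr0, mul0r, mul0rn, expr0n, addr0).
rewrite !rootE derivM derivXsubC mulr1 hornerD hornerM hornerXsubC subrr.
by rewrite mulr0 add0r -rootE expr2 => /factor_theorem[q' ->];
 rewrite -mulrA dvdp_mulIr.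
Qed.

(** Off the diagonal, [(x - y)] times the divided difference is [p(x) - p(y) = 0]; on it, the value
    is [p'(x)], nonzero because roots are simple. This makes an inequality a closed condition. *)
Lemma divdiff_eq0 N p x y : (size p <= N)%N ->
  (forall z, ~~ (('X - z%:P) ^+ 2 %| p)) -> root p x -> root p y ->
  (divdiff N (nth 0 p) x y = 0) <-> (x <> y).
Proof.
move=> sp simple px py; split=> [dd0 xy|/eqP xy].
  move: dd0; rewrite xy divdiffxx // => /rootP p'y.
  by have := simple y; rewrite double_rootE py p'y.
have := divdiffP x y sp; rewrite (rootP px) (rootP py) subrr => /esym/eqP.
by rewrite mulf_eq0 subr_eq0 (negPf xy) => /eqP.
Qed.

End DividedDifference.

Section Orbits.
Variable C : numClosedFieldType.
Implicit Types (g : {poly C}) (x y : C).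

Lemma horner_comp_iter g r x : (comp_iter r g).[x] = iter r (horner g) x.
Proof.
elim: r => [|r IHr]; first by rewrite /comp_iter /= hornerX.
by rewrite /comp_iter iterS horner_comp IHr.
Qed.

Lemma root_comp_iterE g r x :
  root (comp_iter r g - 'X) x = (iter r (horner g) x == x).
Proof. by rewrite rootE !hornerE horner_comp_iter subr_eq0. Qed.

Lemma root_iter g r k x : root (comp_iter r g - 'X) x ->
  root (comp_iter r g - 'X) (iter k (horner g) x).
Proof.
by rewrite !root_comp_iterE => /eqP rx; rewrite -iterD addnC iterD rx.
Qed.

Lemma iter_modn g r k x : iter r (horner g) x = x ->
  iter (k %% r)%N (horner g) x = iter k (horner g) x.
Proof.
move=> rx; rewrite [in RHS](divn_eq k r) addnC iterD; congr iter.
by elim: (k %/ r)%N => // m IHm; rewrite mulSn iterD -IHm rx.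
Qed.

Lemma exact_period_le g r s x : exact_period g r x -> (0 < s)%N ->
  iter s (horner g) x = x -> (r <= s)%N.
Proof.
case=> _ _ minr s0 sx; rewrite leqNgt; apply/negP => sr.
by apply: (minr s); rewrite ?s0.
Qed.

(** If the orbits coincide, each point is an iterate of the other, so each exact period bounds the
    other. Distinctness of orbits thus becomes finitely many inequalities. *)
Lemma forward_orbit_eq g r s x y : exact_period g r x -> exact_period g s y ->
  forward_orbit g x = forward_orbit g y <->
  r = s /\ exists2 k, (k < r)%N & iter k (horner g) x = y.
Proof.
move=> px py; have [r0 rx _] := px; have [s0 sy _] := py.
have per_le u v z m : (0 < u)%N -> iter u (horner g) z = z ->
    exact_period g v (iter m (horner g) z) -> (v <= u)%N.
  move=> u0 uz pv; apply: (exact_period_le pv u0).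
  by rewrite -iterD addnC iterD uz.
split=> [oxy|[_ [k kr xy]]].
  have : forward_orbit g x y by rewrite oxy; exists 0%N.
  case=> k _ xy; have : forward_orbit g y x by rewrite -oxy; exists 0%N.
  case=> m _ yx; split.
    apply/eqP; rewrite eqn_leq (per_le _ _ y m) ?yx //=.
    by rewrite (per_le _ _ x k) ?xy.
  by exists (k %% r)%N; rewrite ?ltn_mod // iter_modn.
apply/seteqP; split=> _ [m _ <-].
  (* From [y], [r - k] further steps close the cycle at [x]. *)
  exists (m + (r - k))%N => //.
  by rewrite -xy -iterD -addnA subnK ?(ltnW kr) // iterD rx.
by exists (m + k)%N => //; rewrite iterD xy.
Qed.

End Orbits.

(** * Differentiability *)

Lemma differentiable_near (K : numFieldType) (V W : normedModType K)
    (f : V -> W) (x : V) (df : {linear V -> W}) : continuous df ->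
  (forall e, 0 < e ->
    \forall a \near x, `|f a - f x - df (a - x)| <= e * `|a - x|) ->
  differentiable f x.
Proof.
move=> dfc fE.
have E : f \o shift x = cst (f x) + df +o_ 0 id.
  apply/eqaddoP => e e0; have := fE e e0; rewrite (near_shift 0) subr0.
  by apply: filterS => h; rewrite /= addrK opprD addrA.
by apply/diff_locallyP; rewrite (diff_unique dfc E).
Qed.

Lemma near_differentiable (K : numFieldType) (V W : normedModType K)
    (f : V -> W) (x : V) e : differentiable f x -> 0 < e ->
  \forall a \near x, `|f a - f x - 'd f x (a - x)| <= e * `|a - x|.
Proof.
move=> /diff_locally /eqaddoP fE e0; have := fE e e0.
rewrite [in X in _ -> X](near_shift 0) subr0.
by apply: filterS => h; rewrite /= addrK opprD addrA.
Qed.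

(* The product rule at a zero of [h] only needs [k] to be continuous. *)
Lemma differentiable_mul_zero (K : numFieldType) (V : normedModType K)
    (f h k : V -> K) (x : V) :
  differentiable h x -> h x = 0 -> {for x, continuous k} ->
  (\forall a \near x, f a = f x + h a * k a) -> differentiable f x.
Proof.
move=> dh hx kc fE; pose df := k x \*: 'd h x.
have dhc : continuous ('d h x) by exact: diff_continuous.
have dfc : continuous df by move=> v; apply: cvgZr; exact: dhc.
apply: (differentiable_near dfc) => e e0.
have [L L0 dhL] := linear_lipschitz dhc.
(* [M] bounds [k] near [x] and [L] is a Lipschitz constant of ['d h x]; the two tolerances make each
   half of the error at most [e / 2] times the distance from [a] to [x]. *)
pose M := `|k x| + 1.
have M0 : 0 < M by rewrite ltr_wpDl.
have e1 : 0 < e / 2 / M by rewrite !divr_gt0.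
have e2 : 0 < e / 2 / L by rewrite !divr_gt0.
near=> a.
have -> : f a - f x - df (a - x) =
    (h a - h x - 'd h x (a - x)) * k a + 'd h x (a - x) * (k a - k x).
  rewrite (_ : f a = f x + h a * k a); last by near: a.
  rewrite hx subr0 [f x + _]addrC addrK mulrBl mulrBr addrA subrK.
  by congr (_ - _); rewrite mulrC.
apply: le_trans (ler_normD _ _) _; rewrite !normrM.
have ha : `|h a - h x - 'd h x (a - x)| <= e / 2 / M * `|a - x|.
  by near: a; exact: near_differentiable.
have ka : `|k a - k x| <= e / 2 / L.
  by rewrite distrC; near: a; apply: cvgr_dist_le.
have kM : `|k a| <= M.
  rewrite -[k a](subrK (k x)) addrC (le_trans (ler_normD _ _)) // lerD2l.
  by rewrite distrC; near: a; apply: cvgr_dist_le.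
rewrite [e]splitr mulrDl lerD //.
  apply: le_trans (ler_pM _ _ ha kM) _ => //.
  by rewrite mulrAC divfK // gt_eqF.
apply: le_trans (ler_pM _ _ (dhL _) ka) _ => //.
by rewrite mulrC mulrA divfK // gt_eqF.
Unshelve. all: by end_near. Qed.

(** Meant for [mderiv j], which is not multiplicative, so morphism rewriting does not apply. *)
Lemma map_poly_MXaddC (R S : nzRingType) (f : R -> S) (p : {poly R}) c :
  f 0 = 0 -> map_poly f (p * 'X + c%:P) = map_poly f p * 'X + (f c)%:P.
Proof.
move=> f0; apply/polyP => i; rewrite coef_map_id0 // !coefD !coefMX !coefC.
by case: i => [|i]; rewrite ?add0r ?addr0 ?coef_map_id0.
Qed.

(** * Differentiation of polynomial functions of the coefficient vector *)

Section Coefficients.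
Variables (C : numClosedFieldType) (n : nat).
Implicit Types (p : mpoly n C) (Q : {poly mpoly n C}) (a : 'rV[C]_n).

Definition eval_at a : {rmorphism mpoly n C -> C} := meval (fun i => a 0 i).

Lemma eval_atX a i : eval_at a (mpolyX C (mnm1 i)) = a 0 i.
Proof. exact: mevalXU. Qed.

Lemma eval_atC a c : eval_at a (mpolyC n c) = c.
Proof. exact: mevalC. Qed.

Lemma mpoly_ring_ind (P : mpoly n C -> Prop) :
  (forall c, P (mpolyC n c)) -> (forall i, P (mpolyX C (mnm1 i))) ->
  (forall p q, P p -> P q -> P (p + q)) ->
  (forall p q, P p -> P q -> P (p * q)) -> forall p, P p.
Proof.
move=> PC PX PD PM; elim/mpolyind => [|c m p _ _ Pp]; first by rewrite -mpolyC0.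
apply: (PD) => //; rewrite -mul_mpolyC; apply: (PM) => //.
rewrite mpolyXE_id.
elim/big_ind: _ => [|x y|i _]; [by rewrite -mpolyC1|exact: PM|].
by elim: (m i) => [|k IHk]; rewrite ?expr0 -?mpolyC1 // exprS; apply: (PM).
Qed.

Lemma differentiable_eval_at p a : differentiable (fun a => eval_at a p) a.
Proof.
elim/mpoly_ring_ind: p => [c|i|p q dp dq|p q dp dq].
- by under eq_fun do rewrite eval_atC; exact: differentiable_cst.
- by under eq_fun do rewrite eval_atX; exact: differentiable_coord.
- by under eq_fun do rewrite rmorphD; exact: differentiableD.
- by under eq_fun do rewrite rmorphM; exact: differentiableM.
Qed.

Lemma is_derive_coord a (v : 'rV[C]_n) i :
  is_derive a v (fun a => a 0 i : C) (v 0 i).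
Proof.
have @f : {linear 'rV[C]_n -> C}.
  by exists (fun N : 'rV[C]_n => N 0 i); do 2![eexists]; do ?[constructor];
     rewrite ?mxE// => ? *; rewrite ?mxE//; move=> ?; rewrite !mxE.
have fc : continuous f by exact: coord_continuous.
have df : differentiable f a by exact: linear_differentiable.
apply: DeriveDef; first exact: diff_derivable.
by transitivity ('D_v f a); rewrite // deriveE // diff_lin.
Qed.

Lemma is_derive_eval_at p a j :
  is_derive a (delta_mx 0 j) (fun a => eval_at a p) (eval_at a (mderiv j p)).
Proof.
elim/mpoly_ring_ind: p => [c|i|p q dp dq|p q dp dq].
- rewrite mderivC rmorph0; under eq_fun do rewrite eval_atC.
  exact: is_derive_cst.
- under eq_fun do rewrite eval_atX.
  apply: is_derive_eq (is_derive_coord _ _ _) _.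
  rewrite mxE eqxx /= mderivX mevalZ mnm1E.
  have [<-|_] := eqVneq; last by rewrite mul0r.
  rewrite (_ : mnm_sub _ _ = mnm0) ?mpolyX0 ?meval1 ?mul1r //.
  by apply/mnmP => k; rewrite mnmBE mnm0E subnn.
- under eq_fun do rewrite rmorphD.
  by rewrite mderivD rmorphD; exact: is_deriveD.
- under eq_fun do rewrite rmorphM.
  apply: is_derive_eq (is_deriveM dp dq) _.
  by rewrite mderivM rmorphD !rmorphM /= addrC; congr (_ + _); rewrite mulrC.
Qed.

(** The chain rule: the first term differentiates the coefficients, the second the argument. Horner
    induction reduces it to the Leibniz rule. *)
Lemma is_derive_horner Q (b : 'rV[C]_n -> C) a j db :
  is_derive a (delta_mx 0 j) b db ->
  is_derive a (delta_mx 0 j) (fun a => (map_poly (eval_at a) Q).[b a])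
    ((map_poly (eval_at a) (map_poly (mderiv j) Q)).[b a] +
     (map_poly (eval_at a) Q^`()).[b a] * db).
Proof.
move=> hb; elim/poly_ind: Q => [|Q c IHQ].
  under eq_fun do rewrite map_poly0 horner0.
  rewrite map_poly0 deriv0 !map_poly0 !horner0 mul0r addr0.
  exact: is_derive_cst.
under eq_fun do rewrite rmorphD rmorphM /= map_polyX map_polyC !hornerE.
have hc := is_derive_eval_at c a j.
apply: is_derive_eq (is_deriveD (is_deriveM IHQ hb) hc) _.
rewrite (map_poly_MXaddC _ _ (mderiv0 _ j)).
rewrite derivD derivM derivX derivC addr0 mulr1 !(rmorphD, rmorphM) /=.
rewrite !map_polyX !map_polyC !hornerE /= /GRing.scale /=.
ring.
Qed.

Lemma differentiable_horner Q x a :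
  differentiable (fun a => (map_poly (eval_at a) Q).[x] : C) a.
Proof.
elim/poly_ind: Q => [|Q c IHQ].
  by under eq_fun do rewrite map_poly0 horner0; exact: differentiable_cst.
under eq_fun do rewrite rmorphD rmorphM /= map_polyX map_polyC !hornerE.
apply: differentiableD; last exact: differentiable_eval_at.
exact: differentiableM (differentiable_cst _ _).
Qed.

End Coefficients.

(** * Holomorphic continuation of a simple root *)

Section Continuation.
Variables (C : numClosedFieldType) (n : nat).
Implicit Types (Q : {poly mpoly n C}) (a : 'rV[C]_n).

Lemma cvgXn T (F : set_system T) {FF : Filter F} (x : T -> C) (x0 : C) k :
  x t @[t --> F] --> x0 -> x t ^+ k @[t --> F] --> x0 ^+ k.
Proof.
move=> hx; elim: k => [|k IHk]; first exact: cvg_cst.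
by under eq_cvg do rewrite exprS; rewrite exprS; exact: cvgM.
Qed.

Lemma cvg_divdiff T (F : set_system T) {FF : Filter F} N Q
    (u : T -> 'rV[C]_n) (x y : T -> C) a (x0 y0 : C) :
  u t @[t --> F] --> a -> x t @[t --> F] --> x0 -> y t @[t --> F] --> y0 ->
  divdiff N (nth 0 (map_poly (eval_at (u t)) Q)) (x t) (y t) @[t --> F]
    --> divdiff N (nth 0 (map_poly (eval_at a) Q)) x0 y0.
Proof.
move=> hu hx hy; apply: cvg_big => [|k _]; first exact: add_continuous.
apply: cvgM.
  rewrite coef_map; under eq_cvg do rewrite coef_map.
  apply: (cvg_comp u (fun a => eval_at a Q`_k) hu).
  exact: (differentiable_continuous (differentiable_eval_at _ _)).
apply: cvg_big => [|i _]; first exact: add_continuous.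
by apply: cvgM; exact: cvgXn.
Qed.

(** The norm of [Q.[x]] is the product of the distances from [x] to the [N] roots. If all their
    [N]-th powers exceeded it, multiplying them would give a strict inequality between its [N]-th
    power and itself. *)
Lemma near_root (Q : {poly C}) x : Q \is monic -> (1 < size Q)%N ->
  exists y, root Q y /\ `|y - x| ^+ (size Q).-1 <= `|Q.[x]|.
Proof.
move=> Qmon sQ; have [rs Qrs] := closed_field_poly_normal Q.
rewrite (monicP Qmon) scale1r in Qrs.
have srs : (size Q).-1 = size rs by rewrite Qrs size_prod_XsubC.
apply: contrapT => noroot.
have lt_rs y : y \in rs -> `|Q.[x]| < `|x - y| ^+ size rs.
  move=> yrs; rewrite real_ltNge ?rpredX ?normr_real //; apply/negP => le_y.
  apply: noroot; exists y; rewrite srs distrC; split=> //.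
  by rewrite Qrs root_prod_XsubC.
have : \prod_(y <- rs) `|Q.[x]| < \prod_(y <- rs) `|x - y| ^+ size rs.
  rewrite !big_seq; apply: ltr_prod => [|y yrs].
    have : (0 < size rs)%N by rewrite -srs -subn1 subn_gt0.
    by case: (rs) => // y s _; rewrite /= mem_head.
  by rewrite normr_ge0 lt_rs.
rewrite big_const_seq count_predT iter_mulr_1 prodrXl -normr_prod.
have -> : \prod_(y <- rs) (x - y) = Q.[x].
  by rewrite Qrs horner_prod; apply: eq_bigr => y _; rewrite hornerXsubC.
by rewrite ltxx.
Qed.

(** The root [b a] is chosen independently for each [a]. The estimate gives continuity at [a0]; the
    divided difference then stays away from zero nearby, which yields continuity and
    differentiability at each nearby [a1]. *)
Lemma exists_continuation Q a0 beta : Q \is monic -> (1 < size Q)%N ->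
  root (map_poly (eval_at a0) Q) beta ->
  ~~ root (map_poly (eval_at a0) Q)^`() beta ->
  exists b : 'rV[C]_n -> C, b a0 = beta /\
    \forall a \near a0, differentiable b a /\
      root (map_poly (eval_at a) Q) (b a).
Proof.
move=> Qmon sQ Qbeta Q'beta; pose q a := map_poly (eval_at a) Q.
have qmon a : q a \is monic by exact: monic_map.
have sq a : size (q a) = size Q.
  by apply: size_map_poly_id0; rewrite (monicP Qmon) rmorph1 oner_eq0.
have /choice[b b_root] a : exists y, root (q a) y /\
    `|y - beta| ^+ (size Q).-1 <= `|(q a).[beta]|.
  by have := @near_root (q a) beta (qmon a); rewrite sq; exact.
have N0 : (0 < (size Q).-1)%N by rewrite -subn1 subn_gt0.
have b0 : b a0 = beta.
  have [_] := b_root a0; rewrite (rootP Qbeta) normr0 => le0.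
  have : `|b a0 - beta| ^+ (size Q).-1 == 0 by rewrite eq_le le0 exprn_ge0.
  by rewrite expf_eq0 N0 normr_eq0 subr_eq0 => /eqP.
exists b; split=> //; pose D a x y := divdiff (size Q) (nth 0 (q a)) x y.
have D0 : D a0 beta beta != 0.
  by rewrite /D divdiffxx ?sq // -rootE.
(* [D a0 beta beta] is the derivative at the simple root, so half its norm is a positive lower bound
   for [D] nearby. *)
pose c := `|D a0 beta beta| / 2.
have c0 : 0 < c by rewrite divr_gt0 // normr_gt0.
have b_near e : 0 < e -> \forall a \near a0, `|b a - beta| < e.
  move=> e0; have : (q a).[beta] @[a --> a0] --> (q a0).[beta].
    exact: (differentiable_continuous (differentiable_horner Q beta a0)).
  rewrite (rootP Qbeta) => /cvgr0_norm_lt /(_ (e ^+ (size Q).-1)).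
  rewrite exprn_gt0 // => /(_ isT).
  apply: filterS => a /(le_lt_trans (b_root a).2).
  by rewrite ltr_pXn2r // ?nnegrE ?ltW.
have b_cvg0 : b a @[a --> a0] --> beta.
  apply/(@cvgrPdist_lt _ _ _ (nbhs a0)) => e e0; have := b_near e e0.
  by apply: filterS => a; rewrite distrC.
have D_near : \forall z \near (a0, (beta, beta)), c < `|D z.1 z.2.1 z.2.2|.
  have Dcvg : D z.1 z.2.1 z.2.2 @[z --> (a0, (beta, beta))] --> D a0 beta beta.
    apply: cvg_divdiff; [exact: cvg_fst| |].
      exact: cvg_comp cvg_snd cvg_fst.
    exact: cvg_comp cvg_snd cvg_snd.
  apply: filterS (cvgr_dist_lt _ _ Dcvg _ c0) => z zc.
  rewrite -(ltrD2l c) -[c + c]splitr -ltrBlDr.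
  exact: le_lt_trans (lerB_dist _ _) zc.
case: D_near => [[U V] /= [Unb [[V1 V2] /= [V1nb V2nb] V12]] UV].
(* Requiring both [V1] and [V2] lets [b a] serve as either argument of [D]. *)
pose W a := [/\ U a, V1 (b a) & V2 (b a)].
have Wnb : \forall a \near a0, W a.
  near=> a; split; near: a => //; exact: b_cvg0.
have W_D a a1 : W a -> W a1 -> c < `|D a (b a) (b a1)|.
  move=> [Ua V1a _] [_ _ V2a1]; apply: (UV (a, (b a, b a1))); split=> //=.
  exact: V12.
(* For [a1] near [a0], [W] also holds around [a1], so differentiability can be proved at [a1]
   itself. *)
apply: filterS (near_join Wnb) => a1 Wnb1; split; last exact: (b_root a1).1.
have Wa1 : W a1 by exact: nbhs_singleton Wnb1.
pose h a := (q a).[b a1].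
have dh : differentiable h a1 by exact: differentiable_horner.
have ha1 : h a1 = 0 by exact/rootP/(b_root a1).1.
have hD a : W a -> b a - b a1 = - h a / D a (b a) (b a1).
  move=> Wa; have Da := W_D a a1 Wa Wa1.
  have Dn0 : D a (b a) (b a1) != 0 by rewrite -normr_gt0 (lt_trans c0).
  have := @divdiffP _ (size Q) (q a) (b a) (b a1); rewrite sq leqnn => /(_ isT).
  by rewrite (rootP (b_root a).1) sub0r => ->; rewrite mulfK.
have b_cvg : b a @[a --> a1] --> b a1.
  have hcvg : h a @[a --> a1] --> (0 : C).
    by rewrite -ha1; exact: differentiable_continuous.
  apply/(@cvgrPdist_lt _ _ _ (nbhs a1)) => e e0; near=> a.
  have Wa : W a by near: a.
  rewrite distrC hD // normrM normrN normfV.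
  rewrite ltr_pdivrMr ?(lt_trans c0 (W_D _ _ _ _)) //.
  apply: (@lt_trans _ _ (e * c)); last by rewrite ltr_pM2l // W_D.
  by near: a; apply: cvgr0_norm_lt => //; rewrite mulr_gt0.
have D1 : D a1 (b a1) (b a1) != 0 by rewrite -normr_gt0 (lt_trans c0) // W_D.
have Dcvg : D a (b a) (b a1) @[a --> a1] --> D a1 (b a1) (b a1).
  exact: (@cvg_divdiff _ (nbhs a1) _ _ _ id b (fun=> b a1) _ _ _
    cvg_id b_cvg (cvg_cst _)).
apply: (differentiable_mul_zero (k := fun a => - (D a (b a) (b a1))^-1) dh ha1).
  exact: (cvgN (cvgV D1 Dcvg)).
near=> a; have Wa : W a by near: a.
by rewrite mulrN -mulNr -hD // addrC subrK.
Unshelve. all: by end_near. Qed.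

End Continuation.

(** * The generic monic polynomial *)

Lemma free_row_free (F : fieldType) l n (v : 'I_l -> 'rV[F]_n) :
  free [tuple v i | i < l] = row_free (\matrix_i v i).
Proof.
have lin (k : 'I_l -> F) : \sum_i k i *: [tuple v i | i < l]`_i =
    (\row_i k i) *m \matrix_i v i.
  rewrite mulmx_sum_row; apply: eq_bigr => i _.
  by rewrite mxE rowK -tnth_nth tnth_mktuple.
apply/freeP/idP => [v_free|vfree k].
  rewrite -kermx_eq0; apply/eqP/row_matrixP => i; rewrite row0.
  apply/rowP => j; rewrite [RHS]mxE.
  apply: (v_free (fun j => row i (kermx _) 0 j)).
  rewrite lin (_ : \row_i _ = row i (kermx (\matrix_i v i))); last first.
    by apply/rowP => ?; rewrite mxE.
  by rewrite -row_mul mulmx_ker row0.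
rewrite lin => /(canRL (mulmxKp vfree)); rewrite mul0mx => /rowP k0 i.
by have := k0 i; rewrite !mxE.
Qed.

Lemma polyfun_divdiff (A C : comNzRingType) T (ev : T -> {rmorphism A -> C}) l
    N (Q : {poly A}) f g :
  @polyfun A C T (fun t => ev t) l f -> @polyfun A C T (fun t => ev t) l g ->
  @polyfun A C T (fun t => ev t) l
    (fun t b => divdiff N (nth 0 (map_poly (ev t) Q)) (f t b) (g t b)).
Proof.
move=> hf hg; apply: polyfun_sum => k; apply: polyfunM.
  by apply: eq_polyfun (polyfun_coef _ _ Q`_k) => t b; rewrite coef_map.
by apply: polyfun_sum => i; apply: polyfunM; exact: polyfunX.
Qed.

Section Generic.
Variables (C : numClosedFieldType) (n : nat).
Implicit Types (a : 'rV[C]_n) (r : nat).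

Definition generic : {poly mpoly n C} :=
  'X^n + \sum_(i < n) mpolyX C (mnm1 i) *: 'X^i.

Definition generic_iter r : {poly mpoly n C} :=
  iter r (fun p => generic \Po p) 'X.

Definition generic_period r : {poly mpoly n C} := generic_iter r - 'X.

Lemma map_generic a : map_poly (eval_at a) generic = monic_of a.
Proof.
rewrite rmorphD /= map_polyXn rmorph_sum /=; congr (_ + _).
by apply: eq_bigr => i _; rewrite map_polyZ map_polyXn eval_atX.
Qed.

Lemma map_generic_iter a r :
  map_poly (eval_at a) (generic_iter r) = comp_iter r (monic_of a).
Proof.
elim: r => [|r IHr]; first by rewrite /generic_iter /= map_polyX.
by rewrite /generic_iter /comp_iter !iterS map_comp_poly map_generic IHr.
Qed.

Lemma map_generic_period a r :
  map_poly (eval_at a) (generic_period r) = comp_iter r (monic_of a) - 'X.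
Proof. by rewrite rmorphB /= map_polyX map_generic_iter. Qed.

Lemma size_generic_tail :
  (size (\sum_(i < n) mpolyX C (mnm1 i) *: 'X^i : {poly mpoly n C})%R <= n)%N.
Proof.
apply: leq_trans (size_sum _ _ _) _; apply/bigmax_leqP => i _.
by apply: leq_trans (size_scale_leq _ _) _; rewrite size_polyXn.
Qed.

Lemma size_generic : size generic = n.+1.
Proof. by rewrite size_polyDl ?size_polyXn // ltnS size_generic_tail. Qed.

Lemma monic_generic : generic \is monic.
Proof.
rewrite monicE lead_coefDl ?lead_coefXn // size_polyXn ltnS.
exact: size_generic_tail.
Qed.

Hypothesis n_gt1 : (1 < n)%N.

Lemma size_generic_iter r : size (generic_iter r) = (n ^ r).+1.
Proof.
elim: r => [|r IHr]; first by rewrite /generic_iter /= size_polyX.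
have := size_comp_poly generic (generic_iter r).
rewrite IHr size_generic /= -/(generic_iter r.+1) => sE.
rewrite -expnS in sE; rewrite -sE prednK // lt0n size_poly_eq0.
(* [sE] fixes only the predecessor of the size, so a zero composite is excluded separately. *)
apply/eqP => g0; move: sE; rewrite g0 size_poly0 => /esym/eqP.
by rewrite expn_eq0; case: n n_gt1.
Qed.

Lemma monic_generic_iter r : generic_iter r \is monic.
Proof.
elim: r => [|r IHr]; first by rewrite /generic_iter /= monicX.
rewrite monicE lead_coef_comp; last first.
  by rewrite size_generic_iter ltnS expn_gt0 ltnW.
by rewrite (monicP monic_generic) (monicP IHr) expr1n mulr1.
Qed.

(** Since [n ^ r > 1], subtracting ['X] leaves the leading term intact. *)
Lemma size_generic_period_gt1 r : (0 < r)%N -> (1 < size (generic_period r))%N.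
Proof.
move=> r0; rewrite size_polyDl size_generic_iter ?size_polyN ?size_polyX.
  by rewrite ltnS expn_gt0 ltnW.
by rewrite ltnS (leq_trans n_gt1) // -{1}(expn1 n) leq_exp2l.
Qed.

Lemma monic_generic_period r : (0 < r)%N -> generic_period r \is monic.
Proof.
move=> r0; rewrite monicE lead_coefDl ?(monicP (monic_generic_iter r)) //.
rewrite size_generic_iter size_polyN size_polyX ltnS (leq_trans n_gt1) //.
by rewrite -{1}(expn1 n) leq_exp2l.
Qed.

(* With [F] the [r]-th iterate, [beta] satisfies [(1 - F_x) beta_j = F_j], so
   [(1 - F_x)] times the [j]-th derivative of [F_x(a, beta(a))] is
   [(1 - F_x) F_xj + F_xx F_j]. *)
Definition scaled_grad r j : {poly mpoly n C} :=
  let F := generic_iter r in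
  (1 - F^`()) * map_poly (mderiv j) F^`() + F^`()^`() * map_poly (mderiv j) F.

(** The scalar [u] is [1 - F_x] at [beta], nonzero because the root is simple. It is the same for
    all [j], so clearing denominators only rescales the gradient. *)
Lemma grad_Mult r a beta : (0 < r)%N -> Zr r a ->
  root (comp_iter r (monic_of a) - 'X) beta ->
  exists2 u : C, u != 0 & forall j,
    u * grad (Mult r a beta) a 0 j =
    (map_poly (eval_at a) (scaled_grad r j)).[beta].
Proof.
move=> r0 Za pbeta; pose F := generic_iter r.
have p'beta : ~~ root (comp_iter r (monic_of a) - 'X)^`() beta.
  by have := Za beta; rewrite /multiple_root double_rootE pbeta.
(* [continuation] is a choice with a default value; it has the defining property once one
   continuation is exhibited. *)
have [cont0 cont_near] : is_continuation r a beta (continuation r a beta).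
  apply: xgetPex; rewrite -map_generic_period in pbeta p'beta.
  have [b [ba hb]] := exists_continuation (monic_generic_period r0)
    (size_generic_period_gt1 r0) pbeta p'beta.
  exists b; split=> //; apply: filterS hb => a1 [db /rootP].
  rewrite map_generic_period !hornerE => /eqP; rewrite subr_eq0 => /eqP.
  by [].
set c := continuation r a beta in cont0 cont_near *.
pose u := 1 - (map_poly (eval_at a) F^`()).[beta].
have u0 : u != 0.
  apply: contra p'beta; rewrite rootE derivB derivX -map_generic_iter.
  by rewrite deriv_map /u !hornerE -oppr_eq0 opprB.
exists u => // j; pose d := 'D_('e_j) c a.
have dc : is_derive a (delta_mx 0 j) c d.
  by apply/derivableP/diff_derivable; case: (nbhs_singleton cont_near).
have udE : u * d = (map_poly (eval_at a) (map_poly (mderiv j) F)).[beta].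
  (* Near [a], [c] is a fixed point of [F]; differentiating both sides gives [d = F_j + F_x * d]. *)
  have hF := is_derive_horner F dc.
  have hc : is_derive a (delta_mx 0 j) c
      ((map_poly (eval_at a) (map_poly (mderiv j) F)).[c a] +
       (map_poly (eval_at a) F^`()).[c a] * d).
    apply: near_eq_is_derive hF; apply: filterS cont_near => a1 [_].
    by rewrite map_generic_iter.
  have dE : d = _ := @derive_val _ _ _ _ _ _ _ hc.
  rewrite mulrBl mul1r {1}dE cont0; ring.
have hM : is_derive a (delta_mx 0 j) (Mult r a beta)
    ((map_poly (eval_at a) (map_poly (mderiv j) F^`())).[c a] +
     (map_poly (eval_at a) F^`()^`()).[c a] * d).
  rewrite (_ : Mult r a beta = fun a => (map_poly (eval_at a) F^`()).[c a]).
    exact: is_derive_horner.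
  by apply/funext => a1; rewrite /Mult -map_generic_iter deriv_map.
rewrite mxE (@derive_val _ _ _ _ _ _ _ hM) cont0 mulrDr mulrCA udE.
rewrite rmorphD !rmorphM rmorphB rmorph1 /= !hornerE -/F -/u.
by [].
Qed.

End Generic.

(** * Bad multiplier gradients *)

Section Main.
Variables (C : numClosedFieldType) (n : nat) (n_gt1 : (1 < n)%N).
Variables (l : nat) (r : 'I_l -> nat) (r_gt0 : forall i, (0 < r i)%N).
Implicit Types (a : 'rV[C]_n) (b : 'I_l -> C).

Local Notation P i := (generic_period C n (r i)).
Local Notation m := (\max_i r i)%N.

(** The triples for which the [k]-th iterate of [b i] must differ from [b j]: [i = j] with [k > 0]
    expresses exactness of the period, and [i != j] with equal periods expresses disjointness of
    cycles. *)
Definition same_cycle_index (i j : 'I_l) (k : nat) : bool :=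
  [&& r i == r j, (i != j) || (0 < k)%N & (k < r i)%N].

Definition admissible a b : Prop :=
  (forall i, exact_period (monic_of a) (r i) (b i)) /\
  (forall i j, i != j ->
     forward_orbit (monic_of a) (b i) <> forward_orbit (monic_of a) (b j)).

(** The boolean factor trivialises the irrelevant triples, so one finite index type serves all; the
    right summand lists the maximal minors of the rescaled gradients. *)
Definition bad_equation (e : 'I_l * 'I_l * 'I_m + {ffun 'I_l -> 'I_n})
    a b : C :=
  match e with
  | inl (i, j, k) => (same_cycle_index i j k)%:R *
      divdiff (size (P i)) (nth 0 (map_poly (eval_at a) (P i)))
        (map_poly (eval_at a) (generic_iter C n k)).[b i] (b j)
  | inr f => \det (\matrix_(i, j)
      (map_poly (eval_at a) (scaled_grad C (r i) (f j))).[b i])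
  end.

Lemma polyfun_bad_equation e :
  polyfun (fun a => eval_at a : mpoly n C -> C) (bad_equation e).
Proof.
case: e => [[[i j] k]|f] /=.
  apply: polyfunM; first exact: polyfun_nat.
  apply: polyfun_divdiff; last exact: polyfun_var.
  exact/polyfun_horner/polyfun_var.
by apply: polyfun_det => i j; exact/polyfun_horner/polyfun_var.
Qed.

(** In each relevant triple [r i = r j], so the iterate of [b i] and [b j] are roots of one
    polynomial with simple roots, and [divdiff_eq0] applies. *)
Lemma admissibleP a b : Z C n r a ->
  admissible a b <->
  (forall i, root (map_poly (eval_at a) (P i)) (b i)) /\
  (forall ijk, bad_equation (inl ijk) a b = 0).
Proof.
move=> Za; have iterE k i :
    (map_poly (eval_at a) (generic_iter C n k)).[b i] =
    iter k (horner (monic_of a)) (b i).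
  by rewrite map_generic_iter horner_comp_iter.
have root_periodE i x : root (map_poly (eval_at a) (P i)) x =
    (iter (r i) (horner (monic_of a)) x == x).
  by rewrite map_generic_period root_comp_iterE.
have eqE i j (k : 'I_m) : (forall i, root (map_poly (eval_at a) (P i)) (b i)) ->
    bad_equation (inl (i, j, k)) a b = 0 <->
    (same_cycle_index i j k -> iter k (horner (monic_of a)) (b i) <> b j).
  move=> bP; rewrite /bad_equation iterE.
  case sij: same_cycle_index; last by rewrite mul0r.
  rewrite mul1r divdiff_eq0 ?map_generic_period ?size_poly //.
  - by split=> // /(_ isT).
  - by rewrite -map_generic_period size_poly.
  - by move=> z; exact: (Za i).
  - by apply: root_iter; rewrite -map_generic_period.
  - by case/and3P: sij => /eqP -> _ _; rewrite -map_generic_period.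
split=> [[ex dist]|[bP eq0]].
  have bP i : root (map_poly (eval_at a) (P i)) (b i).
    by rewrite root_periodE; case: (ex i) => _ ->.
  split=> // -[[i j] k]; apply/eqE => // /and3P[/eqP rij ij kr] bij.
  have [eq_ij|ne_ij] := eqVneq i j.
    rewrite eq_ij eqxx /= in ij kr bij; case: (ex j) => _ _ /(_ k).
    by rewrite ij kr => /(_ isT).
  apply: (dist i j ne_ij); apply/(forward_orbit_eq (ex i) (ex j)).
  by split=> //; exists k.
have neq i j k : same_cycle_index i j k ->
    iter k (horner (monic_of a)) (b i) <> b j.
  move=> sij; have km : (k < m)%N.
    by case/and3P: sij => _ _ /leq_trans; apply; exact: leq_bigmax.
  exact: (eqE i j (Ordinal km) bP).1.
have ex i : exact_period (monic_of a) (r i) (b i).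
  split=> //; first by apply/eqP; rewrite -root_periodE.
  by move=> k /andP[k0 kr]; apply: neq; rewrite /same_cycle_index eqxx eqxx k0.
split=> // i j ij /(forward_orbit_eq (ex i) (ex j))[rij [k kr]].
by apply: neq; rewrite /same_cycle_index rij eqxx ij -rij.
Qed.

(** Row [i] is [u i] times the gradient, so each minor is multiplied by the nonzero product of the
    [u i]. *)
Lemma free_gradP a b : Z C n r a ->
  (forall i, root (map_poly (eval_at a) (P i)) (b i)) ->
  ~ free [tuple grad (Mult (r i) a (b i)) a | i < l] <->
  (forall f, bad_equation (inr f) a b = 0).
Proof.
move=> Za bP; rewrite free_row_free.
have /choice[u uP] i : exists u : C, u != 0 /\ forall j,
    u * grad (Mult (r i) a (b i)) a 0 j =
    (map_poly (eval_at a) (scaled_grad C (r i) j)).[b i].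
  have [||u u0 uE] := @grad_Mult C n n_gt1 (r i) a (b i) (r_gt0 i).
  - exact: (Za i).
  - by rewrite -map_generic_period.
  - by exists u.
set M := \matrix_i _.
have detE f : bad_equation (inr f) a b = \prod_i u i * \det (colsub f M).
  rewrite /bad_equation.
  rewrite (_ : \matrix_(i, j) _ = diag_mx (\row_i u i) *m colsub f M).
    rewrite det_mulmx det_diag; congr (_ * _).
    by apply: eq_bigr => i _; rewrite mxE.
  apply/matrixP => i j; rewrite mul_diag_mx !mxE.
  by rewrite -(uP i).2 mxE.
have u0 : \prod_i u i != 0 by apply/prodf_neq0 => i _; exact: (uP i).1.
split=> [not_free f|eq0 /row_free_minor[f]].
  have [det0|detn0] := eqVneq (\det (colsub f M)) 0.
    by rewrite detE det0 mulr0.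
  by case: not_free; apply/row_free_minor; exists f.
apply/negP/negPn; move: (eq0 f); rewrite detE => /eqP.
by rewrite mulf_eq0 (negPf u0).
Qed.

(** A multiple root is a common root of [P i] and its derivative, so [elimination1] supplies a
    discriminant. *)
Lemma Zr_discriminant i :
  exists D : mpoly n C, forall a, eval_at a D = 0 <-> ~ Zr (r i) a.
Proof.
have [D hD] := @elimination1 _ C (P i) (P i)^`()
  (monic_generic_period C n_gt1 (r_gt0 i))
  (size_generic_period_gt1 C n_gt1 (r_gt0 i)).
exists D => a; rewrite hD -deriv_map map_generic_period.
split=> [[x [px p'x]] /(_ x)|].
  by rewrite /multiple_root double_rootE px p'x.
move=> /existsNP[x /negP]; rewrite negbK /multiple_root double_rootE.
move=> /andP[px p'x].
by exists x.
Qed.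

Lemma Z_discriminant :
  exists D : mpoly n C, forall a, eval_at a D = 0 <-> ~ Z C n r a.
Proof.
have [D hD] := choice Zr_discriminant; exists (\prod_i D i) => a.
rewrite rmorph_prod; split=> [/eqP/prodf_eq0[i _ /eqP/hD nZ] Za|nZ].
  by apply: nZ; exact: Za.
have [i Di] : exists i, eval_at a (D i) = 0.
  apply: contrapT => noD; apply: nZ => i _; apply: contrapT => /hD Di.
  by apply: noD; exists i.
by rewrite (bigD1 i) //= Di mul0r.
Qed.

Lemma Z0_zariski_open : zariski_open (Z0 C n r).
Proof.
have [D hD] := Z_discriminant.
have mpolyCK a : cancel (@mpolyC n C) (eval_at a) by exact: eval_atC.
have [N hN] := elimination_system mpolyCK
  (fun i => monic_generic_period C n_gt1 (r_gt0 i))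
  (fun i => size_generic_period_gt1 C n_gt1 (r_gt0 i)) polyfun_bad_equation.
(* The factor [D] absorbs the complement of [Z]; on [Z] it is nonzero, and the equations reduce to
   those of the [N s]. *)
exists (range (fun s => D * N s)); apply/seteqP; split=> a.
  move=> nZ0 _ [s _ <-]; rewrite -/(eval_at a _) rmorphM.
  have [Za|/hD ->] := pselect (Z C n r a); last by rewrite mul0r.
  suff /hN -> : exists b, (forall i, root (map_poly (eval_at a) (P i)) (b i)) /\
      forall e, bad_equation e a b = 0 by rewrite mulr0.
  move/not_andP: nZ0 => [//|/existsNP[b /not_implyP[ex]]].
  move=> /not_implyP[dist not_free].
  exists b; have [bP eq0] := (admissibleP b Za).1 (conj ex dist).
  by split=> // -[ijk|f]; [exact: eq0|exact: (free_gradP Za bP).1].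
move=> zero [Za all_free].
have Da : eval_at a D <> 0 by move=> /hD.
have /hN[b [bP eq0]] : forall s, eval_at a (N s) = 0.
  move=> s; have /eqP := zero (D * N s) (imageT _ _).
  rewrite -/(eval_at a _) rmorphM mulf_eq0 => /orP[/eqP //|/eqP //].
have [ex dist] := (admissibleP b Za).2 (conj bP (fun ijk => eq0 (inl ijk))).
by apply: (free_gradP Za bP).2 (fun f => eq0 (inr f)) (all_free b ex dist).
Qed.

End Main.

Theorem theorem1p5 (R : realType) (n : nat) (hn : (2 <= n)%N)
    (l : nat) (hl : (0 < l)%N) (r : 'I_l -> nat)
    (hr : forall i, (0 < r i)%N) :
  zariski_open_in (Z R[i] n r) (Z0 R[i] n r) /\
  zariski_open (Z0 R[i] n r).
Proof.
have Z0_open := Z0_zariski_open R[i] hn hr; split=> //.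
by exists (Z0 R[i] n r) => //; apply/seteqP; split=> a [] // Za; split.
Qed.
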